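(* Let $V\subset\mathbb{R}^d$ be a finite or countable set of isolated points, $I=I(V)$, and $W:V\to\mathbb{R}$ a function with $W(x)\neq 0$ for all $x\in V$ and, if $V$ is infinite, $\sum_{x\in V}|x^\alpha||W(x)|<\infty$ for all $\alpha\in\mathbb{N}_0^d$. Let $\{P_\alpha:\alpha\in\Lambda(V)\}$ be a sequence of orthogonal polynomials with respect to $W$ on $V$, with column vectors $\mathbb{P}_k$, and let $H_k=\mathcal{L}(\mathbb{P}_k\mathbb{P}_k^T)$. Then for $0\le k\le\mathbf{n}-1$ and $1\le i\le d$ there exist matrices $A_{k,i}$ of size $r_k\times r_{k+1}$, $B_{k,i}$ of size $r_k\times r_k$, and $C_{k,i}$ of size $r_k\times r_{k-1}$ such that $$x_i\mathbb{P}_k(x)=A_{k,i}\mathbb{P}_{k+1}(x)+B_{k,i}\mathbb{P}_k(x)+C_{k,i}\mathbb{P}_{k-1}(x)\mod I,\qquad 0\le k\le \mathbf{n}-1,$$ where $\mathbb{P}_{-1}:=0$ (so the last term is absent for $k=0$). Moreover, for $0\le k\le\mathbf{n}-1$ and $1\le i\le d$, $$A_{k,i}H_{k+1}=\mathcal{L}(x_i\mathbb{P}_k\mathbb{P}_{k+1}^T)=H_kC_{k+1,i}^T,\qquad B_{k,i}H_k=\mathcal{L}(x_i\mathbb{P}_k\mathbb{P}_k^T),$$ where, if $\mathbf{n}$ is finite, the matrix $C_{\mathbf{n},i}$ of size $r_{\mathbf{n}}\times r_{\mathbf{n}-1}$ is the coefficient of $\mathbb{P}_{\mathbf{n}-1}$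 in the expansion of $x_i\mathbb{P}_{\mathbf{n}}$ modulo $I$ in terms of $\mathbb{P}_0,\dots,\mathbb{P}_{\mathbf{n}}$.
   Context: $\Pi^d=\mathbb{R}[x_1,\dots,x_d]$; $\Pi^d_n$ is the space of polynomials of total degree at most $n$; $x^\alpha=x_1^{\alpha_1}\cdots x_d^{\alpha_d}$, $|\alpha|=\alpha_1+\dots+\alpha_d$. $I(V)$ is the ideal of polynomials vanishing on $V$; $f=g\mod I$ means $f-g\in I$ (entrywise for vectors). A graded monomial order is fixed; $\langle\mathrm{LT}(I(V))\rangle$ is the ideal generated by leading terms of nonzero elements of $I(V)$; $\Lambda(V)=\{\alpha\in\mathbb{N}_0^d: x^\alpha\notin\langle\mathrm{LT}(I(V))\rangle\}$; $\mathbb{R}[V]=\mathrm{span}\{x^\alpha:\alpha\in\Lambda(V)\}$. Put $\mathbf{n}=\max\{|\alpha|:\alpha\in\Lambda(V)\}$ (possibly $\infty$, in which case $0\le k\le\mathbf{n}$ or $0\le k\le \mathbf{n}-1$ means all integers $k\ge0$), $\Lambda_k(V)=\{\alpha\in\Lambda(V):|\alpha|=k\}$, $r_k=|\Lambda_k(V)|$, and $\mathbf{x}^k=\{x^\alpha:\alpha\in\Lambda_k(V)\}$, regarded as a column vector ordered by the monomial order. Let $\mathcal{L}(f)=\sum_{x\in V}f(x)W(x)$, applied entrywise to matrices of polynomials. Given polynomials $P_\alpha\in\mathbb{R}[V]\cap\Pi^d_{|\alpha|}$, $\alpha\in\Lambda(V)$, let $\mathbb{P}_k=\{P_\alpha:\alpha\in\Lambda_k(V)\}$,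 also regarded as a column vector. The sequence is orthogonal with respect to $W$ on $V$ if $\mathcal{L}(\mathbf{x}^l\mathbb{P}_k^T)=0$ for $l<k$ and $\mathcal{L}(\mathbf{x}^k\mathbb{P}_k^T)=S_k$ is an invertible $r_k\times r_k$ matrix, for $0\le k\le\mathbf{n}$. *)

(* Defs.v *)
From HB Require Import structures.
From mathcomp Require Import all_boot all_order all_algebra finmap.
From mathcomp Require Import all_classical all_reals all_analysis.
(* The notations of mpoly clash with those of MathComp-Analysis; they are left
   out and the few that are needed are redeclared below. *)
From mathcomp Require Export -(notations) mpoly.

Set Implicit Arguments.
Unset Strict Implicit.
Unset Printing Implicit Defensive.

Import Order.TTheory GRing.Theory Num.Theory.
Import numFieldNormedType.Exports.

Local Open Scope classical_set_scope.
Local Open Scope ring_scope.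

Notation "{ 'mpoly' T [ n ] }" := (mpoly n T)
  (at level 0, T, n at level 2, format "{ 'mpoly'  T [ n ] }") : type_scope.
Notation "''X_[' m ]" := (@mpolyX _ _ m)
  (at level 0, m at level 2, format "''X_[' m ]") : ring_scope.
Notation "p @_ m" := (mcoeff m p)
  (at level 3, m at level 2, left associativity, format "p @_ m") : ring_scope.

Section Polynomials.
Variables (d : nat) (R : realType).
Implicit Types (p : {mpoly R[d]}) (V : set 'rV[R]_d) (le : rel (multinom d)).

Definition peval p (x : 'rV[R]_d) : R := meval (x ord0) p.

(* Well-foundedness is not listed: there are finitely many monomials of each
   degree, so a graded total order is automatically a well-order. *)
Definition graded_monomial_order le : Prop :=
  [/\ total le, antisymmetric le, transitive le,
      (forall a b c, le a b -> le (mnm_add a c) (mnm_add b c)) &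
      (forall a b, (mdeg a < mdeg b)%N -> le a b)].

Definition lead_monomial le p : multinom d := last mnm0 (sort le (msupp p)).

Definition lead_term le p : {mpoly R[d]} :=
  p@_(lead_monomial le p) *: 'X_[lead_monomial le p].

Definition ideal_gen (S : set {mpoly R[d]}) : set {mpoly R[d]} :=
  [set p | exists (n : nat) (g s : 'I_n -> {mpoly R[d]}),
    (forall j, S (s j)) /\ p = \sum_(j < n) g j * s j].

Definition linear_span (S : set {mpoly R[d]}) : set {mpoly R[d]} :=
  [set p | exists (n : nat) (c : 'I_n -> R) (s : 'I_n -> {mpoly R[d]}),
    (forall j, S (s j)) /\ p = \sum_(j < n) c j *: s j].

Definition vanishing_ideal V : set {mpoly R[d]} :=
  [set p | forall x, V x -> peval p x = 0].

Definition LT_ideal le V : set {mpoly R[d]} :=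
  ideal_gen [set lead_term le p | p in [set p | vanishing_ideal V p /\ p <> 0]].

Definition Lambda le V : set (multinom d) := [set a | ~ LT_ideal le V 'X_[a]].

(* $\mathbb{R}[V]$ *)
Definition std_space le V : set {mpoly R[d]} :=
  linear_span [set 'X_[a] | a in Lambda le V].

(* $\Pi^d_n$; [msize p] is the total degree plus one, and 0 for [p = 0] *)
Definition Pi_deg (n : nat) : set {mpoly R[d]} := [set p | (msize p <= n.+1)%N].

(* $\mathbf{n}$, an extended real since it may be infinite *)
Definition max_degree le V : \bar R :=
  ereal_sup [set (mdeg a)%:R%:E | a in Lambda le V].

Definition Lambda_deg le V (k : nat) : set (multinom d) :=
  [set a | Lambda le V a /\ mdeg a = k].

Definition rk le V (k : nat) : nat := #|` fset_set (Lambda_deg le V k)|%fset.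

(* the $j$-th element of $\Lambda_k(V)$, listed increasingly for [le] *)
Definition Lambda_nth le V (k : nat) (j : 'I_(rk le V k)) : multinom d :=
  nth mnm0 (sort le (fset_set (Lambda_deg le V k))) j.

Definition mon_vec le V (k : nat) : 'cV[{mpoly R[d]}]_(rk le V k) :=
  \col_j 'X_[Lambda_nth j].

Definition poly_vec le V (P : multinom d -> {mpoly R[d]}) (k : nat) :
    'cV[{mpoly R[d]}]_(rk le V k) :=
  \col_j P (Lambda_nth j).

(* $r_{k-1}$ and $\mathbb{P}_{k-1}$, with $r_{-1} = 0$ and
   $\mathbb{P}_{-1} = 0$ *)
Definition rk_pred le V (k : nat) : nat :=
  if k is k'.+1 then rk le V k' else 0%N.

Definition poly_vec_pred le V (P : multinom d -> {mpoly R[d]}) (k : nat) :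
    'cV[{mpoly R[d]}]_(rk_pred le V k) :=
  match k with
  | 0%N => 0
  | k'.+1 => poly_vec le V P k'
  end.

(* entrywise congruence modulo $I(V)$ *)
Definition eq_mod V (m n : nat) (F G : 'M[{mpoly R[d]}]_(m, n)) : Prop :=
  forall i j, vanishing_ideal V ((F - G) i j).

(* multiplication of a polynomial matrix by a scalar matrix *)
Definition smulmx (m n q : nat) (A : 'M[R]_(m, n)) (F : 'M[{mpoly R[d]}]_(n, q)) :
    'M[{mpoly R[d]}]_(m, q) :=
  map_mx (@mpolyC d R) A *m F.

(* The sum of an absolutely summable real family over a set: [esum] is only
   meaningful for nonnegative families, hence the two parts. *)
Definition real_sum V (f : 'rV[R]_d -> R) : R :=
  fine (esum V (EFin \o f)^\+ - esum V (EFin \o f)^\-)%E.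

Definition functional V (W : 'rV[R]_d -> R) p : R :=
  real_sum V (fun x => peval p x * W x).

Definition functional_mx V (W : 'rV[R]_d -> R) (m n : nat)
    (F : 'M[{mpoly R[d]}]_(m, n)) : 'M[R]_(m, n) :=
  map_mx (functional V W) F.

Definition orthogonal_polynomials le V (W : 'rV[R]_d -> R)
    (P : multinom d -> {mpoly R[d]}) : Prop :=
  (forall a, Lambda le V a -> (std_space le V `&` Pi_deg (mdeg a)) (P a)) /\
  forall k : nat, (k%:R%:E <= max_degree le V)%E ->
    (forall l : nat, (l < k)%N ->
       functional_mx V W (mon_vec le V l *m (poly_vec le V P k)^T) = 0) /\
    functional_mx V W (mon_vec le V k *m (poly_vec le V P k)^T) \in unitmx.

Definition Hmx le V (W : 'rV[R]_d -> R) (P : multinom d -> {mpoly R[d]})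
    (k : nat) : 'M[R]_(rk le V k) :=
  functional_mx V W (poly_vec le V P k *m (poly_vec le V P k)^T).

(* The second clause fixes $C_{\mathbf{n},i}$, which does not occur in the
   recurrence, when $\mathbf{n}$ is finite and positive: it is the coefficient
   [E m] of $\mathbb{P}_{\mathbf{n}-1}$ in an expansion of
   $x_i\mathbb{P}_{\mathbf{n}}$. *)
Definition recurrence_coefficients le V (P : multinom d -> {mpoly R[d]})
    (A : forall k : nat, 'I_d -> 'M[R]_(rk le V k, rk le V k.+1))
    (B : forall k : nat, 'I_d -> 'M[R]_(rk le V k, rk le V k))
    (C : forall k : nat, 'I_d -> 'M[R]_(rk le V k, rk_pred le V k)) : Prop :=
  (forall (k : nat) (i : 'I_d), (k%:R%:E <= max_degree le V - 1)%E ->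
     eq_mod V ('X_[mnm1 i] *: poly_vec le V P k)
       (smulmx (A k i) (poly_vec le V P k.+1)
        + smulmx (B k i) (poly_vec le V P k)
        + smulmx (C k i) (poly_vec_pred le V P k))) /\
  (forall (m : nat) (i : 'I_d), max_degree le V = m.+1%:R%:E ->
     exists E : forall j : nat, 'M[R]_(rk le V m.+1, rk le V j),
       eq_mod V ('X_[mnm1 i] *: poly_vec le V P m.+1)
         (\sum_(j < m.+2) smulmx (E j) (poly_vec le V P j)) /\
       C m.+1 i = E m).

End Polynomials.

(* Main.v *)
Require Import Defs.
From HB Require Import structures.
From mathcomp Require Import all_boot all_order all_algebra finmap.
From mathcomp Require Import all_classical all_reals all_analysis.

Set Implicit Arguments.
Unset Strict Implicit.
Unset Printing Implicit Defensive.

Import Order.TTheory GRing.Theory Num.Theory.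
Import numFieldNormedType.Exports.

Local Open Scope classical_set_scope.
Local Open Scope ring_scope.

(** Write [L] for the functional, [P_k] for the vectors of orthogonal
    polynomials, [x^k] for the vectors of standard monomials, and [S_k = L
    (x^k P_k^T)]. [L] is linear and depends only on the values of a
    polynomial on [V], so all identities may be computed modulo the ideal of
    [V]. The proof has two ingredients.

    The first is division. Because the order is graded, rewriting a monomial
    outside [Lambda] by an element of the ideal never raises the degree;
    hence every polynomial of degree at most [n] is, modulo the ideal, a
    combination of standard monomials of degree at most [n]
    ([std_reducible_degree]). With the definition of orthogonality, [P_k] is
    then orthogonal to every polynomial of degree less than [k]
    ([low_degree_orthogonal]), in particular to [P_j] for [j <> k].

    The second is nondegeneracy. If [F = c_0 x^0 + ... + c_n x^n] is
    orthogonal to [P_0, ..., P_n], then pairing with [P_n] gives [c_n S_n =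
    0], so [c_n = 0] since [S_n] is invertible, and one descends: [F] is
    zero modulo the ideal ([functional_nondegenerate]). Two consequences
    follow, for indices up to the maximal degree. The matrix [H_k] is
    invertible, for if [K H_k = 0] then [K P_k] is orthogonal to [P_0, ...,
    P_k], hence zero, hence [K S_k^T = 0] and [K = 0] ([Hmx_unit]). And
    every polynomial of degree at most [n] equals its Fourier sum, with
    coefficients [L (F P_j^T) H_j^-1] ([fourier_expansion]), because the
    difference is orthogonal to [P_0, ..., P_n].

    For [k] below the maximal degree, apply this to [x_i P_k], of degree at
    most [k + 1]. The coefficient of [P_j] involves [L (x_i P_k P_j^T)],
    which is also the pairing of [x_i P_j], of degree at most [j + 1], with
    [P_k], so it vanishes for [j + 1 < k] and three terms remain. When [n]
    is the maximal degree, [x_i P_n] may have degree [n + 1], but there are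
    no standard monomials of that degree, so the expansion stops at [P_n]
    ([mulX_expansion_last]).

    The identities for arbitrary coefficients [A], [B], [C] of such an
    expansion come from pairing it with [P_j] and using orthogonality; the
    one for [C] is the transpose of the pairing of [x_i P_(k+1)] with [P_k]. *)

(** * Linearity of absolutely convergent sums *)

Lemma esumZl (R : realType) (T : choiceType) (D : set T) (c : R)
    (a : T -> \bar R) : 0 <= c -> (forall x, 0 <= a x)%E ->
  (\esum_(x in D) (c%:E * a x) = c%:E * \esum_(x in D) a x)%E.
Proof.
move=> c_ge0 a_ge0; rewrite /esum -ereal_supZl //; last first.
  apply/set0P; exists 0%E, set0; last by rewrite fsbig_set0.
  exact: fsets_set0.
congr ereal_sup; apply/seteqP; split=> y /=.
- move=> [A DA <-]; exists (\sum_(x \in A) a x)%E; first by exists A.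
  by rewrite ge0_mule_fsumr.
- by move=> [_ [A DA <-] <-]; exists A => //; rewrite ge0_mule_fsumr.
Qed.

Section RealSum.
Variables (R : realType) (d : nat) (V : set 'rV[R]_d).
Implicit Types (f g : 'rV[R]_d -> R) (c : R).

Lemma eq_real_sum f g : {in V, f =1 g} -> real_sum V f = real_sum V g.
Proof.
move=> fg; rewrite /real_sum; congr fine; congr (_ - _)%E; apply: eq_esum => x Vx.
  by rewrite !funeposE /= fg ?inE.
by rewrite !funenegE /= fg ?inE.
Qed.

Lemma finite_set_summable f : finite_set V -> summable V (EFin \o f).
Proof.
by move=> finV; rewrite /summable esum_fset //= fsumEFin // ltry.
Qed.

(** Splitting both families into positive and negative parts exhibits
    [f + g] as a difference of two summable nonnegative families; the sum of
    such a difference does not depend on the decomposition. *)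
Lemma real_sumD f g : summable V (EFin \o f) -> summable V (EFin \o g) ->
  real_sum V (f \+ g) = real_sum V f + real_sum V g.
Proof.
move=> sf sg.
have fin (h : 'rV[R]_d -> R) : summable V (EFin \o h) ->
    (esum V (EFin \o h)^\+%E \is a fin_num) && (esum V (EFin \o h)^\-%E \is a fin_num).
  move=> sh; apply/andP; split.
    have := summable_funepos sh; rewrite summableE.
    by rewrite (eq_esum (b := (EFin \o h)^\+%E)) // => x _; rewrite gee0_abs.
  have := summable_funeneg sh; rewrite summableE.
  by rewrite (eq_esum (b := (EFin \o h)^\-%E)) // => x _; rewrite gee0_abs.
have /andP[pf nf] := fin _ sf; have /andP[pg ng] := fin _ sg.
rewrite /real_sum -fineD ?fin_numB ?pf ?nf ?pg ?ng //; congr fine.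
have -> : EFin \o (f \+ g) =
    (((EFin \o f)^\+ \+ (EFin \o g)^\+) \- ((EFin \o f)^\- \+ (EFin \o g)^\-))%E.
  apply/funext => x /=; rewrite EFinD.
  rewrite [in LHS](_ : (f x)%:E = (EFin \o f)^\+ x - (EFin \o f)^\- x)%E; last first.
    by rewrite -[LHS]/((EFin \o f) x) {1}(funeposneg (EFin \o f)).
  rewrite [in LHS](_ : (g x)%:E = (EFin \o g)^\+ x - (EFin \o g)^\- x)%E; last first.
    by rewrite -[LHS]/((EFin \o g) x) {1}(funeposneg (EFin \o g)).
  rewrite !funeposE !funenegE /= -!EFin_max /=.
  by congr EFin; rewrite opprD addrACA.
have spf := summable_funepos sf; have spg := summable_funepos sg.
have snf := summable_funeneg sf; have sng := summable_funeneg sg.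
rewrite esumB //; try exact: summableD; try by move=> x _; exact: adde_ge0.
rewrite !esumD // fin_num_oppeD //.
by rewrite addeACA.
Qed.

(** If the positive or the negative part of [f] diverges, both sides are 0:
    [fine] sends infinite values to 0. *)
Lemma real_sumZ c f : real_sum V (fun x => c * f x) = c * real_sum V f.
Proof.
(* Negation exchanges the positive and the negative part. *)
wlog c_ge0 : c f / 0 <= c => [hwlog|].
  have [/hwlog //|c_lt0] := leP 0 c.
  have := hwlog (- c) (\- f); rewrite oppr_ge0 ltW // => /(_ isT).
  rewrite (@eq_real_sum _ (fun x => c * f x)); last by move=> x _; rewrite mulrNN.
  move=> ->.
  have -> : real_sum V (\- f) = - real_sum V f; last by rewrite mulrNN.
  rewrite /real_sum -fineN.
  rewrite (_ : EFin \o (\- f)%R = (\- (EFin \o f))%E) // funeposN funenegN.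
  set a := esum V _; set b := esum V _.
  have [a0 b0] : (0 <= a /\ 0 <= b)%E by split; exact: esum_ge0.
  by case: a b a0 b0 => [a||] [b||] //= _ _; rewrite ?oppr0 // opprB.
rewrite /real_sum.
set cf := EFin \o _; have {cf}-> : cf = (fun x => c%:E * (EFin \o f) x)%E by [].
rewrite ge0_funeposM // ge0_funenegM // !esumZl //.
set a := esum V _; set b := esum V _.
have [a0 b0] : (0 <= a /\ 0 <= b)%E by split; exact: esum_ge0.
have [->|c_neq0] := eqVneq c 0; first by rewrite !mul0e mul0r sube0.
have c_gt0 : 0 < c by rewrite lt_neqAle eq_sym c_neq0.
case: a b a0 b0 => [a||] [b||] //= _ _;
  by rewrite ?gt0_muley ?gt0_mulye ?lte_fin // ?mulr0 //= mulrBr.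
Qed.

End RealSum.

(** * The functional and congruence modulo the vanishing ideal *)

Section PointEvaluation.
Variables (R : realType) (d : nat).
Implicit Types (p q : {mpoly R[d]}) (x : 'rV[R]_d).

Lemma pevalD p q x : peval (p + q) x = peval p x + peval q x.
Proof. exact: mevalD. Qed.

Lemma pevalB p q x : peval (p - q) x = peval p x - peval q x.
Proof. exact: mevalB. Qed.

Lemma pevalM p q x : peval (p * q) x = peval p x * peval q x.
Proof. exact: mevalM. Qed.

Lemma pevalZ c p x : peval (c *: p) x = c * peval p x.
Proof. exact: mevalZ. Qed.

Lemma peval_sum (I : Type) (r : seq I) (Q : pred I) (F : I -> {mpoly R[d]}) x :
  peval (\sum_(i <- r | Q i) F i) x = \sum_(i <- r | Q i) peval (F i) x.
Proof. exact: raddf_sum. Qed.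

End PointEvaluation.

Section Functional.
Variables (R : realType) (d : nat) (V : set 'rV[R]_d) (W : 'rV[R]_d -> R).
Hypothesis W_summable : infinite_set V -> forall a : multinom d,
  summable V (fun x => (peval 'X_[a] x * W x)%:E).
Implicit Types (p q : {mpoly R[d]}).

Lemma summable_poly p : summable V (EFin \o (fun x => peval p x * W x)).
Proof.
have [finV|infV] := pselect (finite_set V); first exact: finite_set_summable.
rewrite [p]mpolyE; elim: (msupp p) => [|m s IHs].
  rewrite /summable esum1 // => x _ /=.
  by rewrite big_nil /peval meval0 mul0r normr0.
rewrite big_cons; set q := \sum_(j <- s) _ in IHs *.
pose u x := ((p@_m)%:E * (peval 'X_[m] x * W x)%:E)%E.
have -> : EFin \o (fun x => peval (p@_m *: 'X_[m] + q) x * W x) =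
    (u \+ (EFin \o (fun x => (peval q x * W x)%R)))%E.
  by apply/funext => x /=; rewrite pevalD pevalZ mulrDl -mulrA EFinD.
apply: summableD => //; have := W_summable infV m.
rewrite /summable => sm.
under eq_esum do rewrite abseM.
rewrite (@esumZl _ _ _ `|p@_m|) //.
by rewrite lte_mul_pinfty // ?esum_ge0 // lee_fin.
Qed.

Lemma functionalD p q :
  functional V W (p + q) = functional V W p + functional V W q.
Proof.
rewrite /functional -real_sumD; try exact: summable_poly.
by apply: eq_real_sum => x _; rewrite pevalD mulrDl.
Qed.

Lemma functionalZ c p : functional V W (c *: p) = c * functional V W p.
Proof.
rewrite /functional -real_sumZ.
by apply: eq_real_sum => x _; rewrite pevalZ mulrA.
Qed.

Lemma functional0 : functional V W 0 = 0.
Proof. by rewrite -(scale0r 0) functionalZ mul0r. Qed.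

Lemma functional_sum (I : Type) (r : seq I) (Q : pred I) F :
  functional V W (\sum_(i <- r | Q i) F i) =
  \sum_(i <- r | Q i) functional V W (F i).
Proof.
by apply: (big_morph (functional V W)); [exact: functionalD|exact: functional0].
Qed.

(** Only values on [V] enter the sum, so the functional lives on the quotient
    by the ideal of [V]. *)
Lemma functional_eq_mod p q :
  vanishing_ideal V (p - q) -> functional V W p = functional V W q.
Proof.
move=> pq; apply: eq_real_sum => x; rewrite inE => Vx.
by congr (_ * _); apply/eqP; rewrite -subr_eq0 -pevalB pq.
Qed.

Lemma functional_mxD m n (F G : 'M[{mpoly R[d]}]_(m, n)) :
  functional_mx V W (F + G) = functional_mx V W F + functional_mx V W G.
Proof. by apply/matrixP => i j; rewrite !mxE functionalD. Qed.

Lemma functional_mxB m n (F G : 'M[{mpoly R[d]}]_(m, n)) :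
  functional_mx V W (F - G) = functional_mx V W F - functional_mx V W G.
Proof.
apply/matrixP => i j.
by rewrite !mxE functionalD -scaleN1r functionalZ mulN1r.
Qed.

Lemma functional_mx0 m n :
  functional_mx V W (0 : 'M[{mpoly R[d]}]_(m, n)) = 0.
Proof. by apply/matrixP => i j; rewrite !mxE functional0. Qed.

Lemma functional_mx_sum m n (I : Type) (r : seq I)
    (F : I -> 'M[{mpoly R[d]}]_(m, n)) :
  functional_mx V W (\sum_(i <- r) F i) = \sum_(i <- r) functional_mx V W (F i).
Proof.
apply/matrixP => i j; rewrite !mxE !summxE functional_sum.
by apply: eq_bigr => k _; rewrite mxE.
Qed.

Lemma functional_mx_smulmx m n (q : nat) (A : 'M[R]_(m, n))
    (F : 'M[{mpoly R[d]}]_(n, q)) :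
  functional_mx V W (smulmx A F) = A *m functional_mx V W F.
Proof.
apply/matrixP => i j; rewrite !mxE functional_sum.
by apply: eq_bigr => k _; rewrite !mxE mul_mpolyC functionalZ.
Qed.

Lemma functional_mx_tr m n (F : 'M[{mpoly R[d]}]_(m, n)) :
  functional_mx V W F^T = (functional_mx V W F)^T.
Proof. by rewrite /functional_mx map_trmx. Qed.

Lemma functional_mx_eq_mod m n (F G : 'M[{mpoly R[d]}]_(m, n)) :
  eq_mod V F G -> functional_mx V W F = functional_mx V W G.
Proof.
move=> FG; apply/matrixP => i j; rewrite !mxE; apply: functional_eq_mod.
by have := FG i j; rewrite !mxE.
Qed.

End Functional.

Section Congruence.
Variables (R : realType) (d : nat) (V : set 'rV[R]_d).

Lemma eq_modP m n (F G : 'M[{mpoly R[d]}]_(m, n)) :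
  eq_mod V F G <-> forall x, V x -> forall i j, peval (F i j) x = peval (G i j) x.
Proof.
split=> [FG x Vx i j|FG i j x Vx].
  by apply/eqP; rewrite -subr_eq0 -pevalB; have := FG i j x Vx; rewrite !mxE => ->.
by rewrite !mxE pevalB FG // subrr.
Qed.

Lemma eq_mod_trans m n (G F H : 'M[{mpoly R[d]}]_(m, n)) :
  eq_mod V F G -> eq_mod V G H -> eq_mod V F H.
Proof.
move=> /eq_modP FG /eq_modP GH; apply/eq_modP => x Vx i j.
by rewrite FG // GH.
Qed.

Lemma eq_mod_mulr m n (q : nat) (F G : 'M[{mpoly R[d]}]_(m, n))
    (K : 'M[{mpoly R[d]}]_(n, q)) :
  eq_mod V F G -> eq_mod V (F *m K) (G *m K).
Proof.
move=> /eq_modP FG; apply/eq_modP => x Vx i j; rewrite !mxE !peval_sum.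
by apply: eq_bigr => k _; rewrite !pevalM FG.
Qed.

Lemma eq_mod_subr0 m n (F G : 'M[{mpoly R[d]}]_(m, n)) :
  eq_mod V (F - G) 0 <-> eq_mod V F G.
Proof. by split=> FG i j; have := FG i j; rewrite subr0. Qed.

End Congruence.

(** * Division with respect to a graded monomial order *)

Section NormalForm.
Variables (R : realType) (d : nat) (le : rel (multinom d)).
Hypothesis le_order : graded_monomial_order le.
Variable V : set 'rV[R]_d.
Implicit Types (p q : {mpoly R[d]}) (a b m : multinom d) (n k : nat).

Let le_total : total le. Proof. by case: le_order. Qed.
Let le_anti : antisymmetric le. Proof. by case: le_order. Qed.
Let le_trans : transitive le. Proof. by case: le_order. Qed.
Let le_refl : reflexive le. Proof. by move=> a; have := le_total a a; rewrite orbb. Qed.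
Let le_add a b c : le a b -> le (mnm_add a c) (mnm_add b c).
Proof. by case: le_order => _ _ _ + _; exact. Qed.

Lemma le_mdeg a b : le a b -> (mdeg a <= mdeg b)%N.
Proof.
move=> ab; rewrite leqNgt; apply/negP => ba.
have le_ba : le b a by case: le_order => _ _ _ _; exact.
by move: ba; rewrite (le_anti (introT andP (conj ab le_ba))) ltnn.
Qed.

Lemma lead_monomial_max p m : m \in msupp p -> le m (lead_monomial le p).
Proof.
rewrite /lead_monomial -(mem_sort le) => ms; rewrite -nth_last.
rewrite -[X in le X](nth_index mnm0 ms).
have lt_idx : (index m (sort le (msupp p)) < size (sort le (msupp p)))%N.
  by rewrite index_mem.
apply: (sorted_leq_nth le_trans le_refl) => //.
- exact: sort_sorted.
- by rewrite inE; case: size lt_idx.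
- by case: size lt_idx.
Qed.

Lemma lead_monomial_supp p : p != 0 -> lead_monomial le p \in msupp p.
Proof.
rewrite -msupp_eq0 /lead_monomial -(mem_sort le) -nth_last => p_neq0.
by rewrite mem_nth // size_sort; case: (msupp p) p_neq0.
Qed.

(** Divisibility by a leading term: in the expansion of a monomial of the
    ideal over its generators, some summand must contribute to that very
    monomial. *)
Lemma LT_ideal_mon a : LT_ideal le V 'X_[a] -> exists p c,
  [/\ vanishing_ideal V p, p != 0 & a = mnm_add c (lead_monomial le p)].
Proof.
move=> [n [g [s [sP Xa]]]].
have [j gsj] : exists j, (g j * s j)@_a != 0.
  apply/not_existsP => gs0; have /eqP := congr1 (mcoeff a) Xa.
  rewrite mcoeffX eqxx raddf_sum big1 /= ?oner_eq0 // => j _.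
  by apply/eqP/negPn/negP; exact: gs0.
have [p [Ip /eqP p_neq0] sj] := sP j.
move: gsj; rewrite -sj /lead_term -scalerAr mcoeffZ mulf_eq0 negb_or.
move=> /andP[_]; rewrite -mcoeff_msupp (perm_mem (msuppMX _ _)) => /mapP[c _ ->].
by exists p, c; split=> //; rewrite addmC.
Qed.

(** Subtracting a multiple of an element of the ideal with the right leading
    term cancels the monomial and leaves strictly smaller ones. *)
Lemma mon_reduction a : ~ Lambda le V a -> exists q,
  vanishing_ideal V ('X_[a] - q) /\
  forall m, m \in msupp q -> le m a && (m != a).
Proof.
move=> /contrapT /LT_ideal_mon[p [c [Ip p_neq0 aE]]].
set b := lead_monomial le p in aE; have pb : p@_b != 0.
  by rewrite -mcoeff_msupp; exact: lead_monomial_supp.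
exists ('X_[a] - (p@_b)^-1 *: (p * 'X_[c])); split.
  by move=> x Vx; rewrite subKr pevalZ pevalM Ip // mul0r mulr0.
move=> m mq; apply/andP; split; last first.
  apply: contraTN mq => /eqP ->; rewrite -mcoeff_eq0 mcoeffB mcoeffX eqxx.
  by rewrite mcoeffZ aE mcoeffMX mulVf // subrr.
move/msuppB_le : mq; rewrite mem_cat => /orP[|/msuppZ_le].
  by rewrite msuppX mem_seq1 => /eqP ->.
rewrite (perm_mem (msuppMX _ _)) => /mapP[m' m'p ->].
by rewrite aE ![mnm_add c _]addmC le_add // lead_monomial_max.
Qed.

Lemma finite_Lambda_deg k : finite_set (Lambda_deg le V k).
Proof.
apply: (@sub_finite_set _ _ [set bmnm b | b in [set: bmultinom d k.+1]]).
  move=> a [_ ak]; have ltak : (mdeg a < k.+1)%N by rewrite ak.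
  by exists (BMultinom ltak).
exact/finite_image/finite_finset.
Qed.

Lemma mem_Lambda_deg k a :
  (a \in (fset_set (Lambda_deg le V k) : seq _)) = `[< Lambda_deg le V k a >].
Proof.
apply/idP/asboolP => [|La].
  by rewrite (in_fset_set (finite_Lambda_deg k)) inE.
by rewrite (in_fset_set (finite_Lambda_deg k)) inE.
Qed.

Lemma big_Lambda_nth (Z : nmodType) k (G : multinom d -> Z) :
  \sum_(l < rk le V k) G (Lambda_nth l) =
  \sum_(b <- fset_set (Lambda_deg le V k)) G b.
Proof.
rewrite -(perm_big _ (permEl (perm_sort le _))) (big_nth mnm0) big_mkord.
by rewrite size_sort.
Qed.

(** The coefficients are indexed by all multi-indices, so that one
    non-dependent function serves all the degrees at once. *)
Definition std_comb n (c : multinom d -> R) : {mpoly R[d]} :=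
  \sum_(k < n.+1) \sum_(l < rk le V k) c (Lambda_nth l) *: 'X_[Lambda_nth l].

Lemma std_comb_linear n u c c' :
  std_comb n (fun a => u * c a + c' a) = u *: std_comb n c + std_comb n c'.
Proof.
rewrite scaler_sumr -big_split; apply: eq_bigr => k _.
rewrite scaler_sumr -big_split; apply: eq_bigr => l _.
by rewrite scalerDl scalerA.
Qed.

Lemma std_comb_mon n a : Lambda le V a -> (mdeg a <= n)%N ->
  std_comb n (fun b => (b == a)%:R) = 'X_[a].
Proof.
move=> La lean; rewrite /std_comb.
under eq_bigr do rewrite (big_Lambda_nth _ (fun b => (b == a)%:R *: 'X_[b])).
have ltan : (mdeg a < n.+1)%N by [].
rewrite (bigD1 (Ordinal ltan)) //= [X in _ + X]big1 ?addr0 => [|k ka].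
  rewrite (bigD1_seq a) ?fset_uniq ?mem_Lambda_deg ?asboolT //=.
  rewrite eqxx scale1r big1 ?addr0 // => b /negbTE ->.
  by rewrite scale0r.
rewrite big_seq big1 // => b; rewrite mem_Lambda_deg => /asboolP[_ bk].
case: eqP => [ba|_]; last by rewrite scale0r.
by case/eqP: ka; apply: val_inj; rewrite /= -ba.
Qed.

Definition std_reducible n p :=
  exists c, vanishing_ideal V (p - std_comb n c).

Lemma std_reducible_eq_mod n p q :
  vanishing_ideal V (p - q) -> std_reducible n q -> std_reducible n p.
Proof.
move=> pq [c qc]; exists c => x Vx.
by rewrite -(subrKA q) pevalD pq // qc // addr0.
Qed.

Lemma std_reducible_msupp n p :
  (forall m, m \in msupp p -> std_reducible n 'X_[m]) -> std_reducible n p.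
Proof.
move=> red; rewrite [p]mpolyE big_seq.
elim/big_rec: _ => [|m q /red[c mc] [c' qc']].
  exists (fun=> 0) => x Vx; rewrite /std_comb big1 ?subr0 /peval ?meval0 // => k _.
  by rewrite big1 // => l _; rewrite scale0r.
exists (fun a => p@_m * c a + c' a) => x Vx.
rewrite std_comb_linear opprD addrACA -scalerBr pevalD pevalZ mc // qc' //.
by rewrite mulr0 addr0.
Qed.

(** Induction on the number of monomials of degree at most [n] below [a],
    which is finite and decreases at each division step. The count may be
    restricted to degree at most [n] because the order is graded: division
    never raises the degree. *)
Lemma std_reducible_mon n a : (mdeg a <= n)%N -> std_reducible n 'X_[a].
Proof.
pose mu a := #|[pred b : bmultinom d n.+1 | le b a]|.
have [N] := ubnP (mu a); elim: N a => // N IHN a; rewrite ltnS => muaN lean.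
have [La|/mon_reduction[q [aq qa]]] := pselect (Lambda le V a).
  exists (fun b => (b == a)%:R); rewrite std_comb_mon // subrr => x Vx.
  by rewrite /peval meval0.
apply: (std_reducible_eq_mod aq); apply: std_reducible_msupp => m /qa /andP[ma m_neqa].
apply: IHN; last exact: leq_trans (le_mdeg ma) lean.
apply: leq_trans muaN; apply: proper_card; apply/properP; split.
  by apply/fintype.subsetP => b; rewrite !inE => bm; exact: le_trans ma.
have ltan : (mdeg a < n.+1)%N by [].
exists (BMultinom ltan); rewrite !inE //=.
apply: contra m_neqa => am; apply/eqP/le_anti; by rewrite ma am.
Qed.

Lemma std_reducible_degree n p : Pi_deg n p -> std_reducible n p.
Proof.
move=> pn; apply: std_reducible_msupp => m mp; apply: std_reducible_mon.
by rewrite -ltnS; exact: leq_trans (msize_mdeg_lt mp) pn.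
Qed.

Lemma std_reducible_vec n r (F : 'cV[{mpoly R[d]}]_r) :
  (forall i, Pi_deg n (F i ord0)) ->
  exists c : forall k, 'M[R]_(r, rk le V k),
    eq_mod V F (\sum_(k < n.+1) smulmx (c k) (mon_vec le V k)).
Proof.
move=> degF; have /choice[c cP] i := std_reducible_degree (degF i).
exists (fun k => \matrix_(i, l) c i (Lambda_nth l)) => i j.
rewrite ord1 !mxE summxE; have := cP i; congr (vanishing_ideal V (_ - _)).
apply: eq_bigr => k _; rewrite mxE; apply: eq_bigr => l _.
by rewrite !mxE mul_mpolyC.
Qed.

End NormalForm.

(** * Degrees and the range of the index *)

Section DegreeBounds.
Variables (R : realType) (d : nat).
Implicit Types (p q : {mpoly R[d]}) (n k : nat).

Lemma Pi_deg_leq n k p : (n <= k)%N -> Pi_deg n p -> Pi_deg k p.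
Proof. by rewrite -ltnS /Pi_deg /= => nk pn; exact: leq_trans pn nk. Qed.

Lemma Pi_degD n p q : Pi_deg n p -> Pi_deg n q -> Pi_deg n (p + q).
Proof.
move=> pn qn; apply: leq_trans (mmeasureD_le _ _ _) _.
by rewrite geq_max; apply/andP.
Qed.

Lemma Pi_degZ n c p : Pi_deg n p -> Pi_deg n (c *: p).
Proof. by move=> pn; exact: leq_trans (mmeasureZ_le _ _ _) pn. Qed.

Lemma Pi_deg_sum n (I : Type) (r : seq I) (F : I -> {mpoly R[d]}) :
  (forall i, Pi_deg n (F i)) -> Pi_deg n (\sum_(i <- r) F i).
Proof.
move=> Fn; apply: (big_ind (Pi_deg n)) => //; last by move=> p q; exact: Pi_degD.
by rewrite /Pi_deg /= msize0.
Qed.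

Lemma Pi_deg_mulX n i p : Pi_deg n p -> Pi_deg n.+1 ('X_[mnm1 i] * p).
Proof.
rewrite /Pi_deg /= => pn; have [->|p_neq0] := eqVneq p 0; first by rewrite mulr0 msize0.
have X_neq0 : 'X_[mnm1 i] != 0 :> {mpoly R[d]} by rewrite -msize_poly_eq0 msizeX.
by rewrite msizeM // msizeX mdeg1.
Qed.

Lemma Pi_deg_smulmx n (r s : nat) (A : 'M[R]_(r, s)) (F : 'cV[{mpoly R[d]}]_s) :
  (forall l, Pi_deg n (F l ord0)) -> forall j, Pi_deg n (smulmx A F j ord0).
Proof.
move=> Fn j; rewrite mxE; apply: Pi_deg_sum => l.
by rewrite mxE mul_mpolyC; exact: Pi_degZ.
Qed.

End DegreeBounds.

Section MaxDegree.
Variables (R : realType) (d : nat) (le : rel (multinom d)) (V : set 'rV[R]_d).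
Implicit Types (n k : nat).

(** The index condition of the orthogonality hypothesis. The maximal degree
    may be [+oo], when every index is in range, or [-oo], for empty [V], when
    none is. *)
Definition in_range k := (k%:R%:E <= max_degree le V)%E.

Lemma in_range_leq n k : (n <= k)%N -> in_range k -> in_range n.
Proof. by move=> nk; apply: Order.POrderTheory.le_trans; rewrite lee_fin ler_nat. Qed.

Lemma in_range_predE k : (k%:R%:E <= max_degree le V - 1)%E = in_range k.+1.
Proof. by rewrite leeBrDr // -EFinD natr1. Qed.

Lemma Lambda_in_range a : Lambda le V a -> in_range (mdeg a).
Proof. by move=> La; apply: ereal_sup_ubound; exists a. Qed.

Lemma max_degree_eq n : in_range n -> ~ in_range n.+1 ->
  max_degree le V = n%:R%:E.
Proof.
move=> rn nrn; apply/eqP; rewrite eq_le; apply/andP; split=> //.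
apply: ge_ereal_sup => _ [a La <-]; rewrite lee_fin ler_nat leqNgt.
apply/negP => na; apply: nrn; apply: in_range_leq na _.
exact: Lambda_in_range.
Qed.

End MaxDegree.

(** * Orthogonality, nondegeneracy and Fourier expansions *)

Section Orthogonality.
Variables (R : realType) (d : nat) (le : rel (multinom d)).
Hypothesis le_order : graded_monomial_order le.
Variables (V : set 'rV[R]_d) (W : 'rV[R]_d -> R).
Hypothesis W_summable : infinite_set V -> forall a : multinom d,
  summable V (fun x => (peval 'X_[a] x * W x)%:E).
Variable P : multinom d -> {mpoly R[d]}.
Hypothesis P_orthogonal : orthogonal_polynomials le V W P.
Implicit Types (n k l : nat) (i : 'I_d).

Local Notation L := (functional_mx V W).
Local Notation PP := (poly_vec le V P).
Local Notation H := (Hmx le V W P).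
Local Notation in_range := (in_range le V).

Lemma Lambda_nthP k (l : 'I_(rk le V k)) : Lambda_deg le V k (Lambda_nth l).
Proof.
apply/asboolP; rewrite -(mem_Lambda_deg le V) -(mem_sort le).
by rewrite mem_nth // size_sort.
Qed.

Lemma Pi_deg_poly_vec k (l : 'I_(rk le V k)) : Pi_deg k (PP k l ord0).
Proof.
rewrite mxE; have [Ll lk] := Lambda_nthP l.
by have [_] := P_orthogonal.1 _ Ll; rewrite lk.
Qed.

Lemma functional_expansion (m N q : nat) (r : nat -> nat)
    (F : 'cV[{mpoly R[d]}]_m) (G : forall j, 'cV[{mpoly R[d]}]_(r j))
    (c : forall j, 'M[R]_(m, r j)) (K : 'rV[{mpoly R[d]}]_q) :
  eq_mod V F (\sum_(j < N) smulmx (c j) (G j)) ->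
  L (F *m K) = \sum_(j < N) c j *m L (G j *m K).
Proof.
move=> FG; rewrite (functional_mx_eq_mod W (eq_mod_mulr K FG)) mulmx_suml.
rewrite (functional_mx_sum W_summable); apply: eq_bigr => j _.
by rewrite /smulmx -mulmxA (functional_mx_smulmx W_summable).
Qed.

(** The hypothesis only concerns standard monomials; division extends it to
    all polynomials of low degree. *)
Lemma low_degree_orthogonal n k r (F : 'cV[{mpoly R[d]}]_r) :
  (n < k)%N -> in_range k -> (forall j, Pi_deg n (F j ord0)) ->
  L (F *m (PP k)^T) = 0.
Proof.
move=> nk rk Fn; have [c Fc] := std_reducible_vec le_order V Fn.
rewrite (functional_expansion _ Fc) big1 // => j _.
have [orth _] := P_orthogonal.2 _ rk; rewrite orth ?mulmx0 //.
exact: leq_trans nk.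
Qed.

Lemma poly_vec_orthogonal k l : in_range k -> in_range l -> k != l ->
  L (PP k *m (PP l)^T) = 0.
Proof.
move=> rk rl; rewrite neq_ltn => /orP[kl|lk].
  exact: low_degree_orthogonal kl rl (@Pi_deg_poly_vec k).
apply: trmx_inj; rewrite -functional_mx_tr trmx_mul trmxK trmx0.
exact: low_degree_orthogonal lk rk (@Pi_deg_poly_vec l).
Qed.

Lemma Hmx_sym k : (H k)^T = H k.
Proof. by rewrite -functional_mx_tr trmx_mul trmxK. Qed.

(** The Gram matrices of standard monomials against orthogonal polynomials
    form a block triangular system with invertible diagonal blocks, solved from
    the top degree down. *)
Lemma std_expansion_eq0 N r (F : 'cV[{mpoly R[d]}]_r)
    (c : forall j, 'M[R]_(r, rk le V j)) :
  (forall l, (l < N)%N -> in_range l /\ L (F *m (PP l)^T) = 0) ->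
  eq_mod V F (\sum_(j < N) smulmx (c j) (mon_vec le V j)) -> eq_mod V F 0.
Proof.
elim: N => [|N IHN] LF Fc; first by rewrite big_ord0 in Fc.
have [rN] := LF N (ltnSn N); have [xN SN] := P_orthogonal.2 _ rN.
rewrite (functional_expansion _ Fc) big_ord_recr /= big1 => [|j _]; last first.
  by rewrite xN ?mulmx0.
rewrite add0r => cS; have cN : c N = 0 by rewrite -(mulmxK SN (c N)) cS mul0mx.
apply: IHN => [l lN|]; first by apply: LF; exact: ltnW.
by move: Fc; rewrite big_ord_recr /= cN /smulmx map_mx0 mul0mx addr0.
Qed.

Lemma functional_nondegenerate n r (F : 'cV[{mpoly R[d]}]_r) :
  in_range n -> (forall j, Pi_deg n (F j ord0)) ->
  (forall l, (l <= n)%N -> L (F *m (PP l)^T) = 0) -> eq_mod V F 0.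
Proof.
move=> rn Fn LF; have [c Fc] := std_reducible_vec le_order V Fn.
by apply: std_expansion_eq0 Fc => l ln; split; [exact: in_range_leq rn|exact: LF].
Qed.

(** A nonzero row relation of [H k] would give a combination of the degree [k] orthogonal
    polynomials that is orthogonal to all degrees up to [k], hence zero modulo
    the ideal; pairing it with the monomials of degree [k] would contradict the
    invertibility of their Gram matrix. *)
Lemma Hmx_unit k : in_range k -> H k \in unitmx.
Proof.
move=> rk; rewrite -row_free_unit -kermx_eq0; set K := kermx _.
have KP0 : eq_mod V (smulmx K (PP k)) 0.
  apply: (functional_nondegenerate rk).
    exact/Pi_deg_smulmx/Pi_deg_poly_vec.
  move=> l lk; rewrite /smulmx -mulmxA (functional_mx_smulmx W_summable).
  have [->|l_neqk] := eqVneq l k; first exact: mulmx_ker.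
  by rewrite poly_vec_orthogonal ?mulmx0 // 1?eq_sym //; exact: in_range_leq rk.
have [_ Sk] := P_orthogonal.2 _ rk.
have := functional_mx_eq_mod W (eq_mod_mulr (mon_vec le V k)^T KP0).
rewrite mul0mx /smulmx -mulmxA (functional_mx_smulmx W_summable).
rewrite -[_ *m _^T]trmxK trmx_mul trmxK functional_mx_tr.
rewrite functional_mx0 => KS.
have SkT : (L (mon_vec le V k *m (PP k)^T))^T \in unitmx by rewrite unitmx_tr.
by rewrite -[K](mulmxK SkT) KS mul0mx.
Qed.

(** The difference between [F] and its Fourier sum has degree at most [n] and
    is orthogonal to the orthogonal polynomials of degree at most [n], so
    nondegeneracy applies to it. *)
Lemma fourier_expansion n r (F : 'cV[{mpoly R[d]}]_r) :
  in_range n -> (forall j, Pi_deg n (F j ord0)) ->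
  eq_mod V F (\sum_(j < n.+1) smulmx (L (F *m (PP j)^T) *m invmx (H j)) (PP j)).
Proof.
move=> rn Fn; pose D j := L (F *m (PP j)^T) *m invmx (H j).
set S := \sum_(j < _) _; apply/eq_mod_subr0.
have in_r (j : 'I_n.+1) : in_range j by apply: in_range_leq rn; rewrite -ltnS.
apply: (functional_nondegenerate rn) => [j|l ln].
  rewrite !mxE -scaleN1r; apply: Pi_degD; first exact: Fn.
  apply: Pi_degZ; rewrite summxE; apply: Pi_deg_sum => k.
  apply: Pi_deg_smulmx => b; apply: Pi_deg_leq (Pi_deg_poly_vec b).
  by rewrite -ltnS.
have SD : eq_mod V S (\sum_(j < n.+1) smulmx (D j) (PP j)) by apply/eq_modP.
rewrite mulmxBl (functional_mxB W_summable) [X in _ - X](functional_expansion _ SD).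
have ln1 : (l < n.+1)%N by [].
rewrite (bigD1 (Ordinal ln1)) //= mulmxKV; last exact: Hmx_unit (in_r (Ordinal ln1)).
rewrite big1 ?addr0 ?subrr // => j jl.
by rewrite poly_vec_orthogonal ?mulmx0 //; exact: in_r (Ordinal ln1).
Qed.

(** The coefficients depend on [F] modulo the ideal only, so a representative
    [G] of small degree is enough. *)
Lemma fourier_expansion_mod n r (G F : 'cV[{mpoly R[d]}]_r) :
  in_range n -> eq_mod V F G -> (forall j, Pi_deg n (G j ord0)) ->
  eq_mod V F (\sum_(j < n.+1) smulmx (L (F *m (PP j)^T) *m invmx (H j)) (PP j)).
Proof.
move=> rn FG Gn; apply: (eq_mod_trans FG).
under eq_bigr => j _ do rewrite (functional_mx_eq_mod W (eq_mod_mulr _ FG)).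
exact: fourier_expansion.
Qed.

(** * The three-term relation *)

Definition recurrence_coef k i j : 'M[R]_(rk le V k, rk le V j) :=
  L ('X_[mnm1 i] *: (PP k *m (PP j)^T)) *m invmx (H j).

Lemma Pi_deg_mulX_poly_vec k i (l : 'I_(rk le V k)) :
  Pi_deg k.+1 (('X_[mnm1 i] *: PP k) l ord0).
Proof. by rewrite mxE; exact/Pi_deg_mulX/Pi_deg_poly_vec. Qed.

(** Multiplication by a variable is symmetric for the functional: the factor
    can be moved to the polynomials of degree [j], which then still have degree
    less than [k]. *)
Lemma recurrence_coef_low k i j : in_range k -> (j.+1 < k)%N ->
  recurrence_coef k i j = 0.
Proof.
move=> rk jk; rewrite /recurrence_coef [X in X *m _](_ : _ = 0) ?mul0mx //.
apply: trmx_inj; rewrite -functional_mx_tr trmx0 linearZ /= trmx_mul trmxK.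
rewrite scalemxAl; apply: low_degree_orthogonal jk rk _.
exact: Pi_deg_mulX_poly_vec.
Qed.

Lemma mulX_expansion k i : in_range k.+1 ->
  eq_mod V ('X_[mnm1 i] *: PP k)
    (\sum_(j < k.+2) smulmx (recurrence_coef k i j) (PP j)).
Proof.
move=> rk; under eq_bigr do rewrite /recurrence_coef scalemxAl.
exact: fourier_expansion rk (@Pi_deg_mulX_poly_vec k i).
Qed.

(** In the top degree there are no standard monomials of degree [m + 1], so
    the product is congruent to a polynomial of degree at most [m]. *)
Lemma mulX_expansion_last m i : max_degree le V = m%:R%:E ->
  eq_mod V ('X_[mnm1 i] *: PP m)
    (\sum_(j < m.+1) smulmx (recurrence_coef m i j) (PP j)).
Proof.
move=> maxm; have rm : in_range m by rewrite /in_range maxm.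
have [c Fc] := std_reducible_vec le_order V (@Pi_deg_mulX_poly_vec m i).
have no_top (l : 'I_(rk le V m.+1)) : False.
  have [/Lambda_in_range + lm] := Lambda_nthP l.
  by rewrite lm /in_range maxm lee_fin ler_nat ltnn.
have Fc' : eq_mod V ('X_[mnm1 i] *: PP m)
    (\sum_(j < m.+1) smulmx (c j) (mon_vec le V j)).
  move: Fc; rewrite big_ord_recr /= [X in _ + X](_ : _ = 0) ?addr0 //.
  apply/matrixP => a b; rewrite !mxE big1 // => l; by case: (no_top l).
under eq_bigr do rewrite /recurrence_coef scalemxAl.
apply: (fourier_expansion_mod rm Fc') => l.
rewrite summxE; apply: Pi_deg_sum => j.
apply: Pi_deg_smulmx => b; have [_ bj] := Lambda_nthP b.
by rewrite mxE /Pi_deg /= msizeX bj.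
Qed.

Lemma functional_mulX_tr k l i :
  (L ('X_[mnm1 i] *: (PP k *m (PP l)^T)))^T = L ('X_[mnm1 i] *: (PP l *m (PP k)^T)).
Proof. by rewrite -functional_mx_tr linearZ /= trmx_mul trmxK. Qed.

Lemma poly_vec_pred_orthogonal k l : in_range l -> (k <= l)%N ->
  L (poly_vec_pred le V P k *m (PP l)^T) = 0.
Proof.
case: k => [|k] rl kl; first by rewrite /poly_vec_pred mul0mx functional_mx0.
rewrite poly_vec_orthogonal //; first exact: in_range_leq (ltnW kl) rl.
by rewrite neq_ltn kl.
Qed.

Lemma functional_recurrence k i q (K : 'rV[{mpoly R[d]}]_q) A B C :
  eq_mod V ('X_[mnm1 i] *: PP k)
    (smulmx A (PP k.+1) + smulmx B (PP k) + smulmx C (poly_vec_pred le V P k)) ->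
  L ('X_[mnm1 i] *: (PP k *m K)) =
  A *m L (PP k.+1 *m K) + B *m L (PP k *m K) + C *m L (poly_vec_pred le V P k *m K).
Proof.
move=> /(eq_mod_mulr K) /(functional_mx_eq_mod W); rewrite -scalemxAl => ->.
rewrite !mulmxDl !(functional_mxD W_summable) /smulmx -!mulmxA.
by rewrite !(functional_mx_smulmx W_summable).
Qed.

End Orthogonality.

Theorem proposition3p4 (R : realType) (d : nat) (le : rel (multinom d))
  (le_order : graded_monomial_order le)
  (V : set 'rV[R]_d) (V_countable : countable V) (V_isolated : V `<=` isolated V)
  (W : 'rV[R]_d -> R) (W_neq0 : forall x, V x -> W x <> 0)
  (W_summable : infinite_set V -> forall a : multinom d,
     summable V (fun x => (peval 'X_[a] x * W x)%:E))
  (P : multinom d -> {mpoly R[d]})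
  (P_orthogonal : orthogonal_polynomials le V W P) :
  (exists (A : forall k : nat, 'I_d -> 'M[R]_(rk le V k, rk le V k.+1))
          (B : forall k : nat, 'I_d -> 'M[R]_(rk le V k, rk le V k))
          (C : forall k : nat, 'I_d -> 'M[R]_(rk le V k, rk_pred le V k)),
     recurrence_coefficients P A B C) /\
  (forall (A : forall k : nat, 'I_d -> 'M[R]_(rk le V k, rk le V k.+1))
          (B : forall k : nat, 'I_d -> 'M[R]_(rk le V k, rk le V k))
          (C : forall k : nat, 'I_d -> 'M[R]_(rk le V k, rk_pred le V k)),
     recurrence_coefficients P A B C ->
     forall (k : nat) (i : 'I_d), (k%:R%:E <= max_degree le V - 1)%E ->
       [/\ A k i *m Hmx le V W P k.+1 =
             functional_mx V W
               ('X_[mnm1 i] *: (poly_vec le V P k *m (poly_vec le V P k.+1)^T)),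
           functional_mx V W
             ('X_[mnm1 i] *: (poly_vec le V P k *m (poly_vec le V P k.+1)^T)) =
             Hmx le V W P k *m (C k.+1 i)^T &
           B k i *m Hmx le V W P k =
             functional_mx V W
               ('X_[mnm1 i] *: (poly_vec le V P k *m (poly_vec le V P k)^T))]).
Proof.
have in_r k : (k%:R%:E <= max_degree le V - 1)%E -> in_range le V k.+1.
  by rewrite in_range_predE.
pose D := recurrence_coef le V W P.
split.
  pose C k i : 'M[R]_(rk le V k, rk_pred le V k) :=
    if k is k'.+1 return 'M[R]_(rk le V k, rk_pred le V k) then D k'.+1 i k' else 0.
  exists (fun k i => D k i k.+1), (fun k i => D k i k), C; split.
    move=> k i /in_r rk.
    apply: (eq_mod_trans (mulX_expansion le_order W_summable P_orthogonal i rk)).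
    apply/eq_modP => x _ a b; congr (peval (fun_of_matrix _ a b) x).
    rewrite !big_ord_recr /= addrC [X in _ + X]addrC addrA; congr (_ + _ + _).
    rewrite /C; case: k rk a => [|k] rk _; first by rewrite big_ord0 /smulmx mulmx0.
    rewrite big_ord_recr /= big1 ?add0r // => j _.
    rewrite recurrence_coef_low ?ltnS //; last exact: in_range_leq rk.
    by rewrite /smulmx map_mx0 mul0mx.
  move=> m i maxm; exists (D m.+1 i); split=> //.
  exact: mulX_expansion_last.
move=> A B C [rec rec_last] k i /[dup] rk' /in_r rk1.
have rk : in_range le V k by exact: in_range_leq rk1.
have orth a b : in_range le V a -> in_range le V b -> a != b -> _ :=
  @poly_vec_orthogonal _ _ _ le_order _ _ W_summable _ P_orthogonal a b.
have predo a b : in_range le V b -> (a <= b)%N -> _ :=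
  @poly_vec_pred_orthogonal _ _ _ le_order _ _ W_summable _ P_orthogonal a b.
have kk1 : k != k.+1 by rewrite neq_ltn ltnSn.
split.
- rewrite (functional_recurrence W_summable _ (rec k i rk')).
  by rewrite (orth k k.+1) // (predo k k.+1) // !mulmx0 !addr0.
- apply: trmx_inj; rewrite functional_mulX_tr trmx_mul trmxK Hmx_sym.
  (* The coefficient [C k.+1 i] comes from the recurrence at [k.+1], or, when
     [k.+1] is the maximal degree, from the terminal expansion. *)
  have [rk2|nrk2] := pselect (in_range le V k.+2).
    have rk1' : (k.+1%:R%:E <= max_degree le V - 1)%E by rewrite in_range_predE.
    rewrite (functional_recurrence W_summable _ (rec k.+1 i rk1')) /=.
    rewrite (orth k.+2 k) //; last by rewrite neq_ltn ltnS leqnSn orbT.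
    by rewrite (orth k.+1 k) // 1?eq_sym // !mulmx0 !add0r.
  have [E [Erec ->]] := rec_last k i (max_degree_eq rk1 nrk2).
  rewrite scalemxAl (functional_expansion W_summable _ Erec).
  rewrite big_ord_recr big_ord_recr /= big1 => [|j _].
    by rewrite (orth k.+1 k) // 1?eq_sym // mulmx0 add0r addr0.
  rewrite orth ?mulmx0 //; first by apply: in_range_leq rk; exact: ltnW.
  by rewrite neq_ltn ltn_ord.
- rewrite (functional_recurrence W_summable _ (rec k i rk')).
  by rewrite (orth k.+1 k) // 1?eq_sym // (predo k k) // !mulmx0 add0r addr0.
Qed.
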